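(* Let $n\ge1$. The semigroup $(EL_{2n})_{\geq 0}$ acts on the set $\mathcal{P}(n+1)$ of response matrices of planar electrical networks with $n+1$ boundary vertices via $$u_i(a)\cdot L(N)=L(v_i(a)(N))\qquad(1\le i\le 2n,\ a\ge 0,\ N\text{ a planar electrical network with } n+1 \text{ boundary vertices});$$ that is, these formulas give a well-defined action of the semigroup $(EL_{2n})_{\ge 0}$ on $\mathcal{P}(n+1)$.
   Context: The group: $\mathfrak{el}_{2n}$ is the real Lie algebra generated by $e_1,\dots,e_{2n}$ with relations $[e_i,e_j]=0$ for $|i-j|>1$ and $[e_i,[e_i,e_j]]=-2e_i$ for $|i-j|=1$. It is isomorphic to $\mathfrak{sp}_{2n}(\mathbb{R})$ (real $2n\times 2n$ block matrices $\begin{pmatrix} A&B\\ C&D\end{pmatrix}$ with $A=-D^T$, $B=B^T$, $C=C^T$) via $$e_{2i-1}\mapsto\begin{pmatrix}0&a_ia_i^T\\0&0\end{pmatrix},\qquad e_{2i}\mapsto\begin{pmatrix}0&0\\ b_ib_i^T&0\end{pmatrix}\qquad(1\le i\le n),$$ where $\varepsilon_1,\dots,\varepsilon_n$ is the standard basis of $\mathbb{R}^n$, $a_1=\varepsilon_1$, $a_i=\varepsilon_{i-1}+\varepsilon_i$ for $2\le i\le n$, and $b_i=\varepsilon_i$. $EL_{2n}$ is the group $Sp_{2n}(\mathbb{R})$ with Lie algebra identified with $\mathfrak{el}_{2n}$ in this way, $u_i(a)=\exp(ae_i)$, and $(EL_{2n})_{\ge0}$ is the subsemigroup generated by all $u_i(a)$,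 $1\le i\le 2n$, $a\ge0$. Networks: an electrical network $N$ is a finite undirected (multi)graph with positive real edge weights $w(e)$ (conductances), whose vertices are divided into boundary and interior vertices; every connected component is assumed to contain a boundary vertex. Its Kirchhoff matrix $K$ is indexed by all vertices: $K_{ij}=-\sum_{e\text{ joins }i,j}w(e)$ for $i\ne j$ and $K_{ii}=\sum_{e\text{ incident to }i}w(e)$ (loops ignored). The response matrix $L(N)$, indexed by boundary vertices, is the Schur complement $K/K_I$, where $K_I$ is the submatrix indexed by interior vertices. A planar electrical network with $n+1$ boundary vertices is one embedded in a disk, with boundary vertices numbered $1,\dots,n+1$ in circular order on the boundary of the disk and everything else inside. $\mathcal{P}(n+1)\subset\mathbb{R}^{(n+1)^2}$ is the set of response matrices of such networks. Operations: for $t> 0$, $v_{2k-1}(t)(N)$ is obtained from $N$ by adding a new vertex $v$ and an edge of weight $1/t$ from $v$ to boundary vertex $k$, then declaring the old vertex $k$ interior and $v$ to be the new boundary vertex $k$; $v_{2k}(t)(N)$ is obtained by adding an edge of weight $t$ between boundary vertices $k$ and $k+1$. Also $v_i(0)(N)=N$. *)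

(* Defs.v *)
From HB Require Import structures.
From mathcomp Require Import all_boot all_order all_algebra.
From mathcomp Require Import all_classical all_reals all_analysis.

Set Implicit Arguments.
Unset Strict Implicit.
Unset Printing Implicit Defensive.

Import Order.TTheory GRing.Theory Num.Theory.
Import numFieldNormedType.Exports.

Local Open Scope classical_set_scope.
Local Open Scope ring_scope.

(** * The group [EL_2n] and its nonnegative part *)

Section Group.
Context {R : realType}.

(* On square matrices [^+] is the matrix power; the limit is taken in the normed
   space of matrices. *)
Definition mexp m (M : 'M[R]_m) : 'M[R]_m :=
  limn (series (fun k : nat => k`!%:R^-1 *: M ^+ k)).

Variable n : nat.

Definition Jmx : 'M[R]_(n + n) := block_mx 0 1%:M (- 1%:M) 0.

Definition Sp : set 'M[R]_(n + n) := [set M | M^T *m Jmx *m M = Jmx].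

(* Indices are 1-based: [eps 1, ..., eps n] is the standard basis of [R^n]. *)
Definition eps (i : nat) : 'cV[R]_n := \col_(j < n) (j.+1 == i)%:R.

Definition avec (i : nat) : 'cV[R]_n :=
  if i == 1%N then eps 1 else eps i.-1 + eps i.

Definition bvec (i : nat) : 'cV[R]_n := eps i.

(* Image in [sp_2n] of the generator [e_i] of [el_2n], for [1 <= i <= 2n]. *)
Definition egen (i : nat) : 'M[R]_(n + n) :=
  if odd i then block_mx 0 (avec i.+1./2 *m (avec i.+1./2)^T) 0 0
  else block_mx 0 0 (bvec i./2 *m (bvec i./2)^T) 0.

Definition ugen (i : nat) (a : R) : 'M[R]_(n + n) := mexp (a *: egen i).

(* A subset of [Sp], see [EL_ge0_Sp] below. *)
Inductive EL_ge0 : set 'M[R]_(n + n) :=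
| EL_ugen i a : (1 <= i <= 2 * n)%N -> 0 <= a -> EL_ge0 (ugen i a)
| EL_mul g h : EL_ge0 g -> EL_ge0 h -> EL_ge0 (g *m h).

End Group.

Lemma mexp_sqr0 (R : realType) m (M : 'M[R]_m) :
  M *m M = 0 -> mexp M = 1%:M + M.
Proof.
move=> M2; apply: lim_near_cst => //; exists 2%N => //= -[|[|k]] //= _.
rewrite seriesEnat /= big_nat_recl // big_nat_recl // big1 ?addr0 => [|i _].
  by rewrite expr0 expr1 !invr1 !scale1r.
by rewrite exprS exprS mulrA [M * M]M2 mul0r scaler0.
Qed.

Lemma egen_sqr0 (R : realType) n i : egen n i *m egen n i = 0 :> 'M[R]_(n + n).
Proof.
rewrite /egen; case: ifP => _; rewrite mulmx_block !(mul0mx, mulmx0) !addr0;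
by rewrite -[RHS](@block_mx0 R n n n n).
Qed.

Lemma ugenE (R : realType) n i (a : R) : ugen n i a = 1%:M + a *: egen n i.
Proof.
by rewrite /ugen mexp_sqr0 // -scalemxAl -scalemxAr egen_sqr0 !scaler0.
Qed.

Lemma EL_ge0_Sp (R : realType) n : @EL_ge0 R n `<=` @Sp R n.
Proof.
move=> g; elim=> {g} [i a _ _|g h _ Hg _ Hh]; last first.
  rewrite /Sp /= trmx_mul.
  have -> : h^T *m g^T *m Jmx n *m (g *m h) = h^T *m (g^T *m Jmx n *m g) *m h.
    by rewrite !mulmxA.
  by rewrite Hg.
rewrite /Sp /= ugenE /egen; case: ifP => _;
rewrite /Jmx (scalar_mx_block n n 1) scale_block_mx add_block_mx !scaler0
  ?addr0 ?add0r tr_block_mx !trmx0 !trmx1 linearZ /= trmx_mul trmxK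
  !mulmx_block
  !(mul0mx, mulmx0, mul1mx, mulmx1, mulmxN, mulNmx, addr0, add0r, oppr0).
- by rewrite addNr.
- by rewrite addNr.
Qed.

(** * Electrical networks *)

(* The boundary vertices are numbered by ['I_m] (so from [0] on).  The two
   endpoints of an edge are listed in an order which plays no role. *)
Record network (R : realType) (m : nat) := Network {
  interior : finType;
  edge : finType;
  ends : edge -> ('I_m + interior) * ('I_m + interior);
  weight : edge -> R }.

Section Networks.
Context {R : realType} {m : nat}.
Implicit Types N : network R m.

Definition vertex N : finType := ('I_m + interior N)%type.

Definition joins N (e : edge N) (x y : vertex N) : bool :=
  (ends e == (x, y)) || (ends e == (y, x)).

Definition adjacent N : rel (vertex N) :=
  fun x y => [exists e : edge N, joins e x y].

Definition electrical N : Prop :=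
  (forall e : edge N, 0 < weight e) /\
  (forall x : vertex N, exists k : 'I_m, connect (@adjacent N) x (inl k)).

Definition kirchhoff N (x y : vertex N) : R :=
  if x == y then
    \sum_(e : edge N | ((ends e).1 != (ends e).2) &&
                       (((ends e).1 == x) || ((ends e).2 == x))) weight e
  else - \sum_(e : edge N | joins e x y) weight e.

(* The Schur complement [K / K_I]; [K_I] is invertible when [electrical N]. *)
Definition response N : 'M[R]_m :=
  let K := @kirchhoff N in
  let int (i : 'I_#|interior N|) : vertex N := inr (enum_val i) in
  let bd (k : 'I_m) : vertex N := inl k in
  \matrix_(k, l) K (bd k) (bd l)
  - (\matrix_(k, j) K (bd k) (int j))
    *m invmx (\matrix_(i, j) K (int i) (int j))
    *m (\matrix_(i, l) K (int i) (bd l)).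

(** ** Planarity *)

Definition open_disk : set (R * R) := [set p | p.1 ^+ 2 + p.2 ^+ 2 < 1].

Definition circular (p : 'I_m -> R * R) : Prop :=
  exists theta : 'I_m -> R,
    [/\ forall k l : 'I_m, (k < l)%N -> theta k < theta l,
        forall k l : 'I_m, theta l < theta k + 2 * pi
      & forall k : 'I_m, p k = (cos (theta k), sin (theta k))].

(* The arc of [e] is the image of [[0, 1]] under [arc e]; it is a simple closed
   curve if [e] is a loop. *)
Record disk_embedding N (pos : vertex N -> R * R) (arc : edge N -> R -> R * R)
    : Prop := DiskEmbedding {
  de_pos_inj : injective pos;
  de_boundary : circular (fun k => pos (inl k));
  de_interior : forall x : interior N, open_disk (pos (inr x));
  de_continuous : forall e, {within `[0, 1], continuous (arc e)};
  de_ends : forall e, arc e 0 = pos (ends e).1 /\ arc e 1 = pos (ends e).2;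
  de_inside : forall e t, 0 < t < 1 -> open_disk (arc e t);
  de_simple : forall e s t, 0 < s < 1 -> 0 < t < 1 ->
    arc e s = arc e t -> s = t;
  de_vertex : forall e t x, 0 < t < 1 -> arc e t <> pos x;
  de_disjoint : forall e f s t, e != f -> 0 < s < 1 -> 0 < t < 1 ->
    arc e s <> arc f t }.

Definition planar_network N : Prop :=
  electrical N /\ exists pos arc, @disk_embedding N pos arc.

Definition planar_responses : set 'M[R]_m :=
  [set L | exists2 N, planar_network N & L = response N].

(** ** The operations [v_i] *)

Definition add_edge (k l : 'I_m) (t : R) N : network R m :=
  @Network R m (interior N) (option (edge N))
    (fun e => if e is Some e' then ends e' else (inl k, inl l))
    (fun e => if e is Some e' then weight e' else t).

(* The old boundary vertex [k] becomes the interior vertex [None]; the new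
   vertex takes its name. *)
Definition add_spike (k : 'I_m) (t : R) N : network R m :=
  let old (x : vertex N) : 'I_m + option (interior N) :=
    match x with
    | inl l => if l == k then inr None else inl l
    | inr y => inr (Some y)
    end in
  @Network R m (option (interior N)) (option (edge N))
    (fun e => if e is Some e' then (old (ends e').1, old (ends e').2)
              else (inl k, inr None))
    (fun e => if e is Some e' then weight e' else t^-1).

End Networks.

(* The boundary vertex numbered [k] when one counts from [1] to [n + 1]. *)
Definition bdry {n : nat} (k : nat) : 'I_n.+1 := inord k.-1.

Definition vop (R : realType) (n : nat) (i : nat) (t : R)
    (N : network R n.+1) : network R n.+1 :=
  if t == 0 then N
  else if odd i then add_spike (bdry i.+1./2) t N
  else add_edge (bdry i./2) (bdry i./2.+1) t N.

(** * Actions *)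

Definition semigroup_action {R : realType} {p : nat} {Y : Type}
    (S : set 'M[R]_p) (X : set Y) (act : 'M[R]_p -> Y -> Y) : Prop :=
  [/\ forall g x, S g -> X x -> X (act g x),
      forall g h x, S g -> S h -> X x -> act (g *m h) x = act g (act h x)
    & forall x, S 1%:M -> X x -> act 1%:M x = x].

(* Main.v *)
Require Import Defs.
From mathcomp Require Import all_boot all_order all_algebra.
From mathcomp Require Import all_classical all_reals all_analysis.
From mathcomp Require Import ring lra zify.
Import Order.TTheory GRing.Theory Num.Theory.
Local Open Scope ring_scope.

(** A response matrix [L] kills constants on both sides, so it is determined by
    an [n] x [n] matrix [X] with [L = D X D^T], where the columns of [D] are
    the vectors [(-1)^k (eps_k - eps_(k+1))].  On [X] the two kinds of operations
    become
      [X |-> X + t b b^T]   and   [X |-> X (1 + t a a^T X)^-1],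
    because joining [k] to [k+1] adds [t (eps_k - eps_(k+1))(...)^T] to [L], while a
    spike at [k] replaces [L] by [L (1 + t E_kk L)^-1]; the alternating signs in [D]
    are what turns [D^T eps_k] into [+- a_k] with [a_k = eps_(k-1) + eps_k].  These
    are the Moebius transformations [X |-> (C + D' X)(A + B X)^-1] of the matrices
    [[A, B], [C, D']] equal to [exp (t e_i)].  Moebius transformations compose as
    matrices multiply ([moebius_mul]), as long as the denominators [A + B X] that
    occur are invertible.  For a generator this amounts to [1 + t L_kk != 0],
    and [L_kk >= 0] since it is the energy of a harmonic function; the general
    case follows by induction on products ([EL_ge0_stable]), which also needs
    that the operations preserve planarity.

    Both formulas for [L] come from reading [L] as the map that sends boundary
    potentials to the boundary currents of their harmonic extension
    ([response_harmonic]): the harmonic functions of the modified network are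
    written down from those of the original one.

    For planarity ([planar_add_edge], [planar_add_spike]) the given drawing is
    composed with an injective map of the closed disk into itself that moves
    points radially inwards, by a factor which is [1] exactly at the boundary
    vertices that have to stay; the new edge is drawn in the room gained. *)

(** * Harmonic functions on a network *)

Section Laplacian.
Set Implicit Arguments.
Unset Strict Implicit.
Unset Printing Implicit Defensive.
Context {R : realType} {m : nat}.
Implicit Types N : network R m.

Definition incidence N (e : edge N) (x : vertex N) : R :=
  (x == (ends e).1)%:R - (x == (ends e).2)%:R.

(** [K F] for the Kirchhoff matrix [K] (see [sum_kirchhoff]): the current that has
    to enter the network at [x] to maintain the potential [F]. *)
Definition current N (F : vertex N -> R) (x : vertex N) : R :=
  \sum_(e : edge N) weight e * (F (ends e).1 - F (ends e).2) * incidence e x.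

Lemma sum_incidence N (e : edge N) (F : vertex N -> R) :
  \sum_x incidence e x * F x = F (ends e).1 - F (ends e).2.
Proof.
have D z : \sum_x (x == z)%:R * F x = F z.
  rewrite (bigD1 z) //= eqxx mul1r big1 ?addr0 // => x /negPf ->.
  by rewrite mul0r.
by rewrite -!D -sumrB; apply: eq_bigr => x _; rewrite /incidence mulrBl.
Qed.

Lemma kirchhoff_incidence N (x y : vertex N) :
  kirchhoff x y = \sum_(e : edge N) weight e * incidence e x * incidence e y.
Proof.
rewrite /kirchhoff /incidence; case: (eqVneq x y) => [<-|nxy].
  rewrite big_mkcond; apply: eq_bigr => e _.
  rewrite ![x == _]eq_sym.
  have [e1|e1] := eqVneq (ends e).1 x; have [e2|e2] := eqVneq (ends e).2 x;
    rewrite ?orbT ?andbT ?andbF.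
  - by rewrite e1 e2 eqxx subrr mulr0.
  - by rewrite e1 eq_sym e2 subr0 !mulr1.
  - by rewrite e2 e1 sub0r !mulrN1 opprK.
  - by rewrite subrr mulr0.
rewrite big_mkcond -sumrN; apply: eq_bigr => e _.
rewrite /joins; case: (ends e) => a b /=; rewrite !xpair_eqE.
rewrite ![x == _]eq_sym ![y == _]eq_sym.
have nab c : ~~ ((c == x) && (c == y)).
  by apply: contra nxy => /andP[/eqP <-].
move: (nab a) (nab b).
by case: (a == x); case: (a == y); case: (b == x); case: (b == y) => //= _ _;
  rewrite ?mulr0n ?mulr1n !(subrr, subr0, sub0r, oppr0, addr0, mulr0, mul0r,
    mulr1, mulrN1).
Qed.

Lemma sum_kirchhoff N (F : vertex N -> R) x :
  \sum_y kirchhoff x y * F y = current F x.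
Proof.
under eq_bigr do rewrite kirchhoff_incidence mulr_suml.
rewrite exchange_big; apply: eq_bigr => e _ /=.
under eq_bigr do rewrite -mulrA.
by rewrite -mulr_sumr sum_incidence mulrAC.
Qed.

Lemma energyE N (F : vertex N -> R) :
  \sum_x F x * current F x
  = \sum_(e : edge N) weight e * (F (ends e).1 - F (ends e).2) ^+ 2.
Proof.
under eq_bigr do rewrite mulr_sumr.
rewrite exchange_big; apply: eq_bigr => e _ /=.
under eq_bigr do rewrite mulrCA [F _ * _]mulrC.
by rewrite -mulr_sumr sum_incidence expr2 mulrA.
Qed.

Lemma sum_current N (F : vertex N -> R) : \sum_x current F x = 0.
Proof.
rewrite exchange_big big1 //= => e _.
rewrite -mulr_sumr; under eq_bigr do rewrite -[incidence _ _]mulr1.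
by rewrite sum_incidence subrr mulr0.
Qed.

Definition harmonic N (F : vertex N -> R) :=
  forall x : Defs.interior N, current F (inr x) = 0.

Lemma sum_vertex N (G : vertex N -> R) :
  \sum_x G x = \sum_k G (inl k) + \sum_(j < #|Defs.interior N|) G (inr (enum_val j)).
Proof.
by rewrite big_sumType /= -(big_enum_val (fun x => G (inr x))).
Qed.

Lemma energy0_const N (F : vertex N -> R) x y : electrical N ->
  \sum_(e : edge N) weight e * (F (ends e).1 - F (ends e).2) ^+ 2 = 0 ->
  connect (@Defs.adjacent R m N) x y -> F x = F y.
Proof.
move=> [w0 _] /eqP; rewrite psumr_eq0 => [/allP /= E|e _]; last first.
  by rewrite mulr_ge0 ?sqr_ge0 ?ltW.
have Ee e : F (ends e).1 = F (ends e).2.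
  have := E e (mem_index_enum _); rewrite mulf_eq0 gt_eqF //= sqrf_eq0 subr_eq0.
  by move/eqP.
case/connectP=> p; elim: p x => [|z p IH] x /= => [_ -> //|/andP[/existsP[e xz] pp] yE].
rewrite -(IH z pp yE); have := Ee e.
by case/orP: xz => /eqP-> /=.
Qed.

(** With no potential on the boundary and no current inside, the energy
    [\sum_x F x * current F x] is zero, so [F] is constant along edges, and every
    vertex is connected to the boundary. *)
Lemma harmonic_vanish N (F : vertex N -> R) : electrical N -> harmonic F ->
  (forall k, F (inl k) = 0) -> forall x, F x = 0.
Proof.
move=> EN hF F0 x; have [k xk] := EN.2 x.
rewrite (energy0_const EN _ xk) ?F0 // -energyE big_sumType /=.
by rewrite !big1 ?addr0 // => i _; rewrite ?F0 ?mul0r // hF mulr0.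
Qed.

Let int N (i : 'I_#|Defs.interior N|) : vertex N := inr (enum_val i).

Let intmx N : 'M[R]_#|Defs.interior N| :=
  \matrix_(i, j) kirchhoff (int i) (int j).

Lemma intmx_unit N : electrical N -> intmx N \in unitmx.
Proof.
move=> EN; rewrite -unitmx_tr -row_free_unit; apply: inj_row_free => v v0.
pose F (x : vertex N) := if x is inr y then v 0 (enum_rank y) else 0.
have F0 : forall x, F x = 0.
  apply: harmonic_vanish => // x.
  rewrite -sum_kirchhoff sum_vertex big1 ?add0r => [|k _]; last by rewrite mulr0.
  move/matrixP: v0 => /(_ 0 (enum_rank x)); rewrite !mxE => {2}<-.
  by apply: eq_bigr => j _; rewrite !mxE /int /= enum_valK enum_rankK mulrC.
apply/rowP=> j; rewrite mxE -[RHS](F0 (inr (enum_val j))) /=.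
by rewrite enum_valK.
Qed.

(** The Schur complement eliminates the interior equations [K_ib f + K_ii g = 0],
    which say precisely that the function made of [f] and [g] is harmonic. *)
Lemma response_harmonic N (F : vertex N -> R) : electrical N -> harmonic F ->
  response N *m \col_k F (inl k) = \col_k current F (inl k).
Proof.
move=> EN hF; set f := \col_k _.
pose g := \col_(j < #|Defs.interior N|) F (int j).
rewrite /response -/(intmx N).
set Kbb := \matrix_(k, l) _; set Kbi := \matrix_(k, j) _; set Kib := \matrix_(i, l) _.
have Hi : Kib *m f = - (intmx N *m g).
  apply/eqP; rewrite -subr_eq0 opprK; apply/eqP/colP=> i; rewrite !mxE.
  rewrite -[RHS](hF (enum_val i)) -sum_kirchhoff sum_vertex.
  by congr (_ + _); apply: eq_bigr => j _; rewrite !mxE.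
rewrite mulmxBl -!mulmxA Hi !mulmxN mulKmx ?intmx_unit // opprK.
apply/colP=> k; rewrite !mxE -sum_kirchhoff sum_vertex.
by congr (_ + _); apply: eq_bigr => j _; rewrite !mxE.
Qed.

Lemma harmonic_extension N (f : 'cV[R]_m) : electrical N ->
  exists2 F : vertex N -> R, harmonic F & f = \col_k F (inl k).
Proof.
move=> EN.
pose Kib := \matrix_(i, l) kirchhoff (int i) (inl l : vertex N).
pose g := - (invmx (intmx N) *m (Kib *m f)).
exists (fun x => match x with inl k => f k 0 | inr y => g (enum_rank y) 0 end).
  move=> x; rewrite -sum_kirchhoff sum_vertex.
  transitivity ((Kib *m f + intmx N *m g) (enum_rank x) 0); last first.
    by rewrite mulmxN mulKVmx ?intmx_unit // subrr mxE.
  rewrite mxE [X in _ = X + _]mxE [X in _ = _ + X]mxE.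
  congr (_ + _); apply: eq_bigr => j _.
    by rewrite [X in _ = X * _]mxE /int enum_rankK.
  by rewrite [X in _ = X * _]mxE /int enum_rankK enum_valK.
by apply/colP=> k; rewrite mxE.
Qed.

Lemma eq_mulmx_cV p (A B : 'M[R]_(p, m)) :
  (forall f : 'cV[R]_m, A *m f = B *m f) -> A = B.
Proof.
by move=> E; apply/trmx_inj/row_matrixP => j; rewrite -!tr_col !colE E.
Qed.

Lemma response_ones N : electrical N -> response N *m const_mx 1 = 0 :> 'cV_m.
Proof.
move=> EN; have c0 x : current (fun _ : vertex N => 1) x = 0.
  by rewrite /current big1 // => e _; rewrite subrr mulr0 mul0r.
have := response_harmonic EN (fun x => c0 (inr x)).
have -> : \col_k 1 = const_mx 1 :> 'cV[R]_m by apply/colP=> k; rewrite !mxE.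
by move->; apply/colP=> k; rewrite !mxE.
Qed.

(** Currents sum to zero over all vertices, and harmonic functions have no
    interior current. *)
Lemma ones_response N : electrical N -> const_mx 1 *m response N = 0 :> 'rV_m.
Proof.
move=> EN; apply: eq_mulmx_cV => f.
have [F hF ->] := harmonic_extension f EN.
rewrite -mulmxA response_harmonic // mul0mx; apply/rowP=> i; rewrite !mxE.
rewrite -[RHS](sum_current F) big_sumType /= [X in _ = _ + X]big1 // addr0.
by apply: eq_bigr => k _; rewrite !mxE mul1r.
Qed.

(** [L k k] is the energy of the harmonic function with boundary values [delta_k]. *)
Lemma response_diag_ge0 N k : electrical N -> 0 <= response N k k.
Proof.
move=> EN; have [F hF fE] := harmonic_extension (delta_mx k 0 : 'cV_m) EN.
have : 0 <= \sum_x F x * current F x.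
  by rewrite energyE sumr_ge0 // => e _; rewrite mulr_ge0 ?sqr_ge0 ?ltW // EN.1.
have FE l : F (inl l) = (l == k)%:R.
  by have /colP/(_ l) := fE; rewrite !mxE andbT => ->.
rewrite big_sumType /= [X in _ + X]big1 => [|x _]; last by rewrite hF mulr0.
rewrite addr0 (bigD1 k) //= big1 => [|l /negPf lk]; last by rewrite FE lk mul0r.
rewrite FE eqxx mul1r addr0.
have /colP/(_ k) := response_harmonic EN hF.
by rewrite -fE -colE !mxE => ->.
Qed.

End Laplacian.

(** * The two operations on networks *)

Section Operations.
Set Implicit Arguments.
Unset Strict Implicit.
Unset Printing Implicit Defensive.
Context {R : realType} {m : nat}.
Implicit Types N : network R m.

Lemma big_option (I : finType) (G : option I -> R) :
  \sum_(x : option I) G x = G None + \sum_(i : I) G (Some i).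
Proof.
rewrite (bigD1 None) //=; congr (_ + _).
rewrite (reindex_omap Some id) /=; last by case.
by apply: eq_bigl => i; rewrite eqxx.
Qed.

Lemma current_add_edge N k l t (F : vertex N -> R) (x : vertex N) :
  current (N := add_edge k l t N) F x
  = current F x + t * (F (inl k) - F (inl l)) * ((x == inl k)%:R - (x == inl l)%:R).
Proof. by rewrite /current big_option addrC. Qed.

Definition gap (k l : 'I_m) : 'cV[R]_m := delta_mx k 0 - delta_mx l 0.

Lemma electrical_add_edge N k l t : 0 < t -> electrical N ->
  electrical (add_edge k l t N).
Proof.
move=> t0 [w0 cN]; split; first by case.
move=> x; have [j xj] := cN x; exists j; apply: connect_sub xj => y z yz.
apply: connect1; case/existsP: yz => e ye; apply/existsP; exists (Some e).
exact: ye.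
Qed.

(** The new edge has boundary ends, so the same functions are harmonic; only their
    boundary currents change. *)
Lemma response_add_edge N k l t : 0 < t -> electrical N ->
  response (add_edge k l t N) = response N + t *: (gap k l *m (gap k l)^T).
Proof.
move=> t0 EN; apply: eq_mulmx_cV => f.
have [F hF ->] := harmonic_extension f EN.
have hF' : harmonic (N := add_edge k l t N) F.
  by move=> x; rewrite current_add_edge hF subrr mulr0 addr0.
rewrite (response_harmonic (electrical_add_edge k l t0 EN) hF').
rewrite mulmxDl response_harmonic // -scalemxAl -mulmxA.
have -> : (gap k l)^T *m \col_k F (inl k) = (F (inl k) - F (inl l))%:M.
  have D z : \sum_(j < m) (j == z)%:R * F (inl j) = F (inl z).
    rewrite (bigD1 z) //= eqxx mul1r big1 ?addr0 // => x /negPf ->.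
    by rewrite mul0r.
  apply/matrixP => i j; rewrite !ord1 !mxE -!D -sumrB mulr1n.
  by apply: eq_bigr => x _; rewrite !mxE !andbT mulrBl.
rewrite mul_mx_scalar scalerA.
by apply/colP=> i; rewrite mxE current_add_edge !mxE !andbT.
Qed.

(** The inclusion of the old vertices in the vertices of [add_spike k t N]. *)
Definition demote (N : network R m) (k : 'I_m) (x : vertex N) :
    'I_m + option (Defs.interior N) :=
  match x with
  | inl l => if l == k then inr None else inl l
  | inr y => inr (Some y)
  end.

Lemma demote_inj N k : injective (@demote N k).
Proof.
move=> [i|x] [j|y] /=.
- by case: eqP => [->|_]; case: eqP => [->|_] // [->].
- by case: eqP.
- by case: eqP.
- by case=> ->.
Qed.

Lemma demote_neq N k (x : vertex N) : demote k x != inl k.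
Proof. by case: x => [i|x] //=; case: ifP => //= /negbT. Qed.

Lemma demoteP N k (P : 'I_m + option (Defs.interior N) -> Prop) :
  P (inl k) -> (forall x : vertex N, P (demote k x)) -> forall y, P y.
Proof.
move=> Pk Pd [l|[y|]]; last 2 first.
- exact: (Pd (inr y)).
- by have := Pd (inl k); rewrite /= eqxx.
by have [->//|/negPf lk] := eqVneq l k; have := Pd (inl l); rewrite /= lk.
Qed.

Lemma electrical_add_spike N k t : 0 < t -> electrical N ->
  electrical (add_spike k t N).
Proof.
move=> t0 [w0 cN]; split; first by case=> //=; rewrite invr_gt0.
have kN : connect (@Defs.adjacent R m (add_spike k t N)) (inr None) (inl k).
  by apply: connect1; apply/existsP; exists None; rewrite /joins [X in _ || X]eqxx orbT.
apply: demoteP => [|x]; first by exists k.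
have [j /connectP[p]] := cN x.
elim: p x => [|z p IH] x /=.
  by move=> _ <- /=; case: eqP => _; [exists k | exists j].
move=> /andP[/existsP[e xz] pp] /(IH _ pp)[i zi]; exists i.
apply: connect_trans zi; apply: connect1; apply/existsP; exists (Some e).
by case/orP: xz => /eqP xz; rewrite /joins /= xz eqxx ?orbT.
Qed.

(** Pushing the current [c] through the spike, of resistance [t], costs a drop of
    potential [t * c]; with [t * c] in place of [c] this is the potential which
    continues [F] to the tip of the spike. *)
Definition spike_potential N (k : 'I_m) (c : R) (F : vertex N -> R)
    (x : 'I_m + option (Defs.interior N)) : R :=
  match x with
  | inl l => if l == k then F (inl k) + c else F (inl l)
  | inr None => F (inl k)
  | inr (Some y) => F (inr y)
  end.

Lemma spike_potential_demote N k c (F : vertex N -> R) x :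
  spike_potential k c F (demote k x) = F x.
Proof. by case: x => [l|x] //=; case: ifP => [/eqP->|/= ->]. Qed.

(** The new edge brings the current [c] to the old vertex [k], where it is no longer
    supplied from outside. *)
Lemma current_add_spike N k t c (F : vertex N -> R) (x : vertex N) : t != 0 ->
  current (N := add_spike k t N) (spike_potential k (t * c) F) (demote k x)
  = current F x - c * (x == inl k)%:R.
Proof.
move=> t0; rewrite /current big_option addrC; congr (_ + _).
  apply: eq_bigr => e _; rewrite /= !spike_potential_demote; congr (_ * _).
  by rewrite /incidence /= !(inj_eq (@demote_inj N k)).
rewrite /= eqxx addrAC subrr add0r mulrA mulVf // mul1r /incidence /=.
rewrite (negPf (demote_neq _ _)) sub0r mulrN; congr (- (_ * _%:R)).
have -> : inr None = demote k (inl k : vertex N) by rewrite /= eqxx.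
by rewrite (inj_eq (@demote_inj N k)).
Qed.

Lemma current_spike N k t c (F : vertex N -> R) : t != 0 ->
  current (N := add_spike k t N) (spike_potential k (t * c) F) (inl k)
  = c.
Proof.
move=> t0; rewrite /current big_option big1 ?addr0 => [|e _]; last first.
  have -> : incidence (N := add_spike k t N) (Some e) (inl k)
      = (inl k == demote k (ends e).1)%:R - (inl k == demote k (ends e).2)%:R.
    by [].
  by rewrite ![inl k == _]eq_sym !(negPf (demote_neq _ _)) subrr mulr0.
rewrite /= eqxx addrAC subrr add0r mulrA mulVf // mul1r /incidence /=.
by rewrite eqxx subr0 mulr1.
Qed.

(** If [F] is harmonic with boundary values [f], then the spike carries the
    current [(L f)_k], so the boundary values of the continued potential are
    [f + t (L f)_k eps_k], and the boundary currents are still [L f]. *)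
Lemma response_add_spike N k t : 0 < t -> electrical N ->
  response (add_spike k t N) *m (1%:M + t *: (delta_mx k k *m response N))
  = response N.
Proof.
move=> t0 EN; have tn0 : t != 0 by rewrite gt_eqF.
apply: eq_mulmx_cV => f; have [F hF ->] := harmonic_extension f EN.
pose F' := spike_potential k (t * current F (inl k)) F.
have hF' : harmonic (N := add_spike k t N) F'.
  have H x : current F x = 0 \/ x = inl k ->
    current (N := add_spike k t N) F' (demote k x) = 0.
    rewrite current_add_spike //; case: eqVneq => [-> _|xk [->|xE]].
    - by rewrite mulr1 subrr.
    - by rewrite mulr0 subr0.
    - by rewrite xE eqxx in xk.
  move=> [y|]; first exact: (H (inr y) (or_introl (hF y))).
  by have /= := H (inl k) (or_intror erefl); rewrite eqxx.
have F'E : \col_j F' (inl j)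
    = (1%:M + t *: (delta_mx k k *m response N)) *m \col_j F (inl j).
  rewrite mulmxDl mul1mx -scalemxAl -mulmxA response_harmonic //.
  apply/colP=> j; rewrite !mxE (bigD1 k) //= big1 ?addr0 => [|i /negPf ik].
    by rewrite !mxE eqxx andbT; case: eqVneq => [->|_];
      rewrite ?mul1r // mul0r mulr0 addr0.
  by rewrite !mxE ik andbF mul0r.
rewrite -mulmxA -F'E (response_harmonic (electrical_add_spike k t0 EN) hF').
rewrite response_harmonic //; apply/colP => j; rewrite !mxE.
have [->|/negPf jk] := eqVneq j k; first exact: current_spike.
have := current_add_spike k (current F (inl k)) F (inl j) tn0; rewrite /= jk => ->.
by rewrite eqE /= jk mulr0 subr0.
Qed.

End Operations.

(** * Moebius transformations and reduced response matrices *)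

Section Moebius.
Set Implicit Arguments.
Unset Strict Implicit.
Unset Printing Implicit Defensive.
Context {R : realType} {n : nat}.
Implicit Types (g h : 'M[R]_(n + n)) (X Y : 'M[R]_n).

(** [g *m col_mx 1 X = col_mx (den g X) (num g X)]: a Moebius transformation is
    the action of [g] on the graphs of the matrices [X]. *)
Definition den g X := ulsubmx g + ursubmx g *m X.
Definition num g X := dlsubmx g + drsubmx g *m X.
Definition moebius g X := num g X *m invmx (den g X).

Lemma moebius_eq g X Y : den g X \in unitmx ->
  Y *m den g X = num g X -> moebius g X = Y.
Proof. by move=> dU E; rewrite /moebius -E mulmxK. Qed.

Lemma den_mul g h X : den h X \in unitmx ->
  den (g *m h) X = den g (moebius h X) *m den h X.
Proof.
move=> dU; rewrite -{1}[g]submxK -{1}[h]submxK mulmx_block /den.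
rewrite block_mxKul block_mxKur (mulmxDl _ _ (den h X)) -!mulmxA mulVmx // mulmx1.
by rewrite /den /num !mulmxDr !mulmxDl !mulmxA addrACA.
Qed.

Lemma num_mul g h X : den h X \in unitmx ->
  num (g *m h) X = num g (moebius h X) *m den h X.
Proof.
move=> dU; rewrite -{1}[g]submxK -{1}[h]submxK mulmx_block /num.
rewrite block_mxKdl block_mxKdr (mulmxDl _ _ (den h X)) -!mulmxA mulVmx // mulmx1.
by rewrite /den /num !mulmxDr !mulmxDl !mulmxA addrACA.
Qed.

Lemma moebius_mul g h X : den h X \in unitmx ->
  den g (moebius h X) \in unitmx ->
  den (g *m h) X \in unitmx /\ moebius (g *m h) X = moebius g (moebius h X).
Proof.
move=> hU gU; have dU : den (g *m h) X \in unitmx.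
  by rewrite den_mul // unitmx_mul gU.
split=> //; apply: moebius_eq => //.
by rewrite den_mul // mulmxA mulmxKV // -num_mul.
Qed.

Lemma den1 X : den 1%:M X = 1%:M.
Proof. by rewrite /den scalar_mx_block block_mxKul block_mxKur mul0mx addr0. Qed.

Lemma moebius1 X : moebius 1%:M X = X.
Proof.
apply: moebius_eq; first by rewrite den1 unitmx1.
by rewrite den1 mulmx1 /num scalar_mx_block block_mxKdl block_mxKdr mul1mx add0r.
Qed.

Lemma ugen_odd i (a : R) : odd i ->
  ugen n i a = block_mx 1%:M (a *: (avec n i.+1./2 *m (avec n i.+1./2)^T)) 0 1%:M.
Proof.
move=> oi; rewrite ugenE /egen oi scalar_mx_block scale_block_mx add_block_mx.
by rewrite !scaler0 !addr0 add0r.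
Qed.

Lemma ugen_even i (a : R) : ~~ odd i ->
  ugen n i a = block_mx 1%:M 0 (a *: (bvec n i./2 *m (bvec n i./2)^T)) 1%:M.
Proof.
move=> /negPf oi; rewrite ugenE /egen oi scalar_mx_block scale_block_mx add_block_mx.
by rewrite !scaler0 !addr0 add0r.
Qed.

(** If [v] is in the kernel, then multiplying [v + v w u = 0] by [w] gives
    [v w (1 + u w) = 0], so [v w = 0], and then [v = 0]. *)
Lemma unitmx_rank1 p (w : 'cV[R]_p) (u : 'rV[R]_p) :
  1 + (u *m w) 0 0 != 0 -> 1%:M + w *m u \in unitmx.
Proof.
move=> nz; rewrite -row_free_unit; apply: inj_row_free => v.
rewrite mulmxDr mulmx1 mulmxA => E.
have vw : (v *m w) 0 0 = 0.
  have /matrixP/(_ 0 0) : (v + v *m w *m u) *m w = 0 by rewrite E mul0mx.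
  move: nz; rewrite mulmxDl -mulmxA; move: (v *m w) (u *m w) => s q nz.
  rewrite mxE [(s *m q) 0 0]mxE big_ord1 [RHS]mxE -{1}[s 0 0]mulr1 -mulrDr.
  by move/eqP; rewrite mulf_eq0 (negPf nz) orbF => /eqP.
move: E; have -> : v *m w = 0 by apply/matrixP=> i j; rewrite !ord1 vw mxE.
by rewrite mul0mx addr0.
Qed.

(** The columns span the vectors with zero sum.  The alternating signs make the
    first [n] rows equal, up to sign, to the vectors [avec] (see [row_diffmx]), whose
    nonzero entries have the same sign. *)
Definition diffmx : 'M[R]_(n.+1, n) :=
  \matrix_(k, j) ((-1) ^+ j * ((k == j :> nat)%:R - (k == j.+1 :> nat)%:R)).

Definition summx : 'M[R]_(n, n.+1) := \matrix_(j, k) ((-1) ^+ j * (k <= j)%N%:R).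

Lemma sum_delta p k (G : nat -> R) :
  \sum_(j < p) (k == j :> nat)%:R * G j = (k < p)%N%:R * G k.
Proof.
case: ltnP => [kp|pk]; last first.
  by rewrite big1 ?mul0r // => j _; rewrite gtn_eqF ?mul0r // (leq_trans _ pk).
rewrite (bigD1 (Ordinal kp)) //= eqxx big1 ?addr0 // => j.
by rewrite -val_eqE /= eq_sym => /negPf ->; rewrite mul0r.
Qed.

Lemma summx_diffmx : summx *m diffmx = 1%:M.
Proof.
apply/matrixP=> i j; rewrite !mxE.
transitivity ((-1) ^+ (i + j) * (\sum_(k < n.+1) (j == k :> nat)%:R * (k <= i)%N%:R
    - \sum_(k < n.+1) (j.+1 == k :> nat)%:R * (k <= i)%N%:R) : R).
  rewrite -sumrB mulr_sumr; apply: eq_bigr => k _; rewrite !mxE exprD.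
  by rewrite [_ == (k : nat)]eq_sym [j.+1 == _]eq_sym; ring.
rewrite (sum_delta _ j (fun k => (k <= i)%N%:R)).
rewrite (sum_delta _ j.+1 (fun k => (k <= i)%N%:R)) ltnS (ltnW (ltn_ord j)).
rewrite ltnS ltn_ord !mul1r -val_eqE /=.
case: ltngtP => [ij|ji|->]; rewrite ?subrr ?mulr0 // subr0 mulr1 -signr_odd.
by rewrite oddD addbb.
Qed.

(** Reconstructing a vector from its partial sums recovers all entries, except
    that the last one is replaced by minus the sum of the others. *)
Lemma diffmx_summx :
  diffmx *m summx = 1%:M - (delta_mx ord_max 0 : 'cV_n.+1) *m const_mx 1.
Proof.
apply/matrixP=> k l; rewrite !mxE big_ord1 !mxE andbT mulr1.
transitivity (\sum_(j < n) (k == j :> nat)%:R * (l <= j)%N%:R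
    - \sum_(j < n) (k == j.+1 :> nat)%:R * (l <= j)%N%:R : R).
  rewrite -sumrB; apply: eq_bigr => j _; rewrite !mxE.
  rewrite mulrACA -expr2 sqrr_sign mul1r mulrBl //.
rewrite (sum_delta _ k (fun j => (l <= j)%N%:R)).
have -> : \sum_(j < n) (k == j.+1 :> nat)%:R * (l <= j)%N%:R
    = (0 < k)%N%:R * (l <= k.-1)%N%:R :> R.
  case: k => [[|k] /= kn]; first by rewrite big1 ?mul0r // => j _; rewrite mul0r.
  under eq_bigr do rewrite eqSS.
  by rewrite (sum_delta _ k (fun j => (l <= j)%N%:R)) -ltnS kn.
rewrite -!natrM !mulnb -!val_eqE /=; case: k l => [k kn] [l ln] /=.
have -> : (k < n)%N = (k != n) by rewrite ltn_neqAle -(ltnS k) kn andbT.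
have -> : ((0 < k) && (l <= k.-1))%N = (l < k)%N by case: k kn => [|k] //=; rewrite ltnS.
have [->|kl] := eqVneq k n.
  rewrite sub0r /= (ltn_neqAle l) -(ltnS l) ln andbT eq_sym.
  by case: eqP => _; rewrite ?subrr ?sub0r ?oppr0.
by rewrite subr0; case: ltngtP => _; rewrite ?subrr ?subr0.
Qed.

Lemma row_diffmx (k : 'I_n) :
  row (widen_ord (leqnSn n) k) diffmx = (-1) ^+ k *: (avec n k.+1)^T.
Proof.
apply/rowP=> j; rewrite !mxE /avec /eps; case: k => [[|k] kn] /=.
  by rewrite !mxE subr0 eqSS eq_sym; case: eqVneq => [->|_]; rewrite ?mulr0.
rewrite !mxE !eqSS [k.+1 == _]eq_sym [k == _]eq_sym.
case: eqVneq => [->|jk]; case: eqVneq => [jk'|_] /=.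
- by exfalso; lia.
- by rewrite subr0 add0r.
- by rewrite jk' sub0r addr0 exprS mulN1r mulNr mulrN.
- by rewrite subrr addr0 !mulr0.
Qed.

Lemma diffmx_bvec (k : 'I_n) :
  diffmx *m bvec n k.+1
  = (-1) ^+ k *: gap (widen_ord (leqnSn n) k) (lift ord0 k).
Proof.
have -> : bvec n k.+1 = delta_mx k 0 :> 'cV[R]_n.
  by apply/colP => j; rewrite !mxE eqSS andbT.
rewrite -colE; apply/colP=> i; rewrite !mxE !andbT -!val_eqE /=.
by [].
Qed.


Definition reduce (L : 'M[R]_n.+1) : 'M[R]_n := summx *m L *m summx^T.

Definition act (g : 'M[R]_(n + n)) (L : 'M[R]_n.+1) : 'M[R]_n.+1 :=
  diffmx *m moebius g (reduce L) *m diffmx^T.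

Lemma diffmx_reducel (L : 'M[R]_n.+1) : const_mx 1 *m L = 0 :> 'rV_n.+1 ->
  diffmx *m (summx *m L) = L.
Proof.
by move=> L0; rewrite mulmxA diffmx_summx mulmxBl mul1mx -mulmxA L0 mulmx0 subr0.
Qed.

Lemma diffmx_reducer (L : 'M[R]_n.+1) : L *m const_mx 1 = 0 :> 'cV_n.+1 ->
  L *m summx^T *m diffmx^T = L.
Proof.
move=> L0; apply: trmx_inj; rewrite !trmx_mul !trmxK.
rewrite diffmx_reducel //; apply: trmx_inj.
by rewrite trmx_mul trmxK trmx_const trmx0.
Qed.

Lemma reduceK (N : network R n.+1) : electrical N ->
  diffmx *m reduce (response N) *m diffmx^T = response N.
Proof.
move=> EN; rewrite /reduce mulmxA diffmx_reducel ?ones_response //.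
by rewrite diffmx_reducer // response_ones.
Qed.

Lemma reduce_act g (L : 'M[R]_n.+1) :
  reduce (act g L) = moebius g (reduce L).
Proof.
rewrite {1}/reduce /act !mulmxA summx_diffmx mul1mx -mulmxA -trmx_mul.
by rewrite summx_diffmx trmx1 mulmx1.
Qed.

Lemma tr_avec (k : 'I_n) : (avec n k.+1)^T
  = (-1) ^+ k *: (delta_mx 0 (widen_ord (leqnSn n) k) *m diffmx) :> 'rV[R]_n.
Proof. by rewrite -rowE row_diffmx scalerA -expr2 sqrr_sign scale1r. Qed.

Lemma avecE (k : 'I_n) : avec n k.+1
  = (-1) ^+ k *: (diffmx^T *m delta_mx (widen_ord (leqnSn n) k) 0) :> 'cV[R]_n.
Proof. by rewrite -[LHS]trmxK tr_avec linearZ /= trmx_mul trmx_delta. Qed.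

Lemma avec_sqr (k : 'I_n) (i := widen_ord (leqnSn n) k) :
  avec n k.+1 *m (avec n k.+1)^T = diffmx^T *m delta_mx i i *m diffmx :> 'M[R]_n.
Proof.
rewrite tr_avec avecE -scalemxAl -scalemxAr scalerA -expr2 sqrr_sign scale1r.
by rewrite mulmxA; congr (_ *m _); rewrite -mulmxA mul_delta_mx.
Qed.

(** Compressing [L' (1 + a E_jj L) = L] by [summx] gives [X' (1 + a w w^T X) = X],
    where [w] is the vector [avec], since [w w^T = D^T E_jj D].  The factor
    [1 + a w w^T X] is invertible because [w^T X w = L_jj >= 0]. *)
Lemma act_ugen_odd (N : network R n.+1) i a :
  electrical N -> odd i -> (i <= 2 * n)%N -> 0 < a ->
  den (ugen n i a) (reduce (response N)) \in unitmx /\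
  act (ugen n i a) (response N) = response (add_spike (bdry i.+1./2) a N).
Proof.
move=> EN oi ln a0.
have kn : (i./2 < n)%N by lia.
have -> : i.+1./2 = i./2.+1 by lia.
pose k := Ordinal kn; pose j := widen_ord (leqnSn n) k.
have -> : bdry i./2.+1 = j by apply: val_inj; rewrite /= inordK //= ltnS ltnW.
set N' := add_spike j a N.
have EN' : electrical N' by apply: electrical_add_spike.
have NL : response N' *m (1%:M + a *: (delta_mx j j *m response N)) = response N.
  exact: response_add_spike.
set X := reduce (response N).
have aE : avec n k.+1 *m (avec n k.+1)^T = diffmx^T *m delta_mx j j *m diffmx :> 'M[R]_n.
  exact: avec_sqr.
have uE : ugen n i a = block_mx 1%:M (a *: (avec n k.+1 *m (avec n k.+1)^T)) 0 1%:M.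
  by rewrite ugen_odd //; have -> : i.+1./2 = i./2.+1 by lia.
have dE : den (ugen n i a) X = 1%:M + a *: (avec n k.+1 *m (avec n k.+1)^T) *m X.
  by rewrite uE /den block_mxKul block_mxKur.
have dU : den (ugen n i a) X \in unitmx.
  rewrite dE scalemxAl -mulmxA; apply: unitmx_rank1.
  rewrite -scalemxAr mxE.
  have -> : ((avec n k.+1)^T *m X *m avec n k.+1) 0 0 = response N j j.
    rewrite tr_avec avecE -/j -!scalemxAl -scalemxAr scalerA -expr2 sqrr_sign scale1r.
    rewrite mulmxA -(mulmxA _ diffmx) -(mulmxA _ (diffmx *m X)) reduceK //.
    by rewrite -colE -rowE !mxE.
  rewrite gt_eqF // ltr_pwDl //; apply: mulr_ge0; first exact: ltW.
  exact: response_diag_ge0.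
split=> //; rewrite /act -/X.
rewrite (moebius_eq (Y := reduce (response N')) dU) ?reduceK //.
rewrite dE uE /num block_mxKdl block_mxKdr mul1mx add0r.
rewrite mulmxDr mulmx1 aE.
transitivity (summx *m (response N' *m
    (1%:M + a *: (delta_mx j j *m response N))) *m summx^T); last by rewrite NL.
rewrite (mulmxDr (response N')) mulmx1 mulmxDr mulmxDl; congr (_ + _).
rewrite -!(scalemxAl, scalemxAr); congr (a *: _).
rewrite -[in RHS](diffmx_reducer (response_ones EN')).
rewrite -[in RHS](diffmx_reducel (ones_response EN)).
by rewrite /X /reduce !mulmxA.
Qed.

Lemma act_ugen_even (N : network R n.+1) i a :
  electrical N -> ~~ odd i -> (1 <= i <= 2 * n)%N -> 0 < a ->
  den (ugen n i a) (reduce (response N)) \in unitmx /\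
  act (ugen n i a) (response N)
  = response (add_edge (bdry i./2) (bdry i./2.+1) a N).
Proof.
move=> EN oi /andP[i0 ln] a0.
have kn : (i./2.-1 < n)%N by lia.
pose k := Ordinal kn.
have iE : i./2 = k.+1 by rewrite /=; lia.
have -> : bdry i./2 = widen_ord (leqnSn n) k.
  by apply: val_inj; rewrite iE /= inordK //= ltnS ltnW.
have -> : bdry i./2.+1 = lift ord0 k by apply: val_inj; rewrite iE /= inordK.
rewrite response_add_edge //.
set X := reduce (response N).
have uE : ugen n i a = block_mx 1%:M 0 (a *: (bvec n k.+1 *m (bvec n k.+1)^T)) 1%:M.
  by rewrite ugen_even // iE.
have dE : den (ugen n i a) X = 1%:M.
  by rewrite uE /den block_mxKul block_mxKur mul0mx addr0.
split; first by rewrite dE unitmx1.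
have mE : moebius (ugen n i a) X = X + a *: (bvec n k.+1 *m (bvec n k.+1)^T).
  apply: moebius_eq; rewrite dE ?unitmx1 // mulmx1 uE /num block_mxKdl block_mxKdr.
  by rewrite mul1mx addrC.
rewrite /act -/X mE mulmxDr mulmxDl reduceK //; congr (_ + _).
rewrite -scalemxAr -scalemxAl mulmxA -(mulmxA (diffmx *m _)) -trmx_mul.
rewrite diffmx_bvec; congr (_ *: _).
by rewrite linearZ /= -scalemxAl -scalemxAr scalerA -expr2 sqrr_sign scale1r.
Qed.

End Moebius.

(** * Shrinking the disk away from its boundary *)

Section Plane.
Set Implicit Arguments.
Unset Strict Implicit.
Unset Printing Implicit Defensive.
Import numFieldNormedType.Exports.
Local Open Scope classical_set_scope.
Context {R : realType}.
Implicit Types (p q : R * R) (a b : R).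

Definition sqnorm p := p.1 ^+ 2 + p.2 ^+ 2.

Lemma sqnormZ a p : sqnorm (a *: p) = a ^+ 2 * sqnorm p.
Proof. by rewrite /sqnorm /= !exprMn mulrDr. Qed.

Lemma norm_le1 p : sqnorm p <= 1 -> `|p| <= 1.
Proof.
move=> p1; have := sqr_ge0 p.1; have := sqr_ge0 p.2.
rewrite /sqnorm in p1 => h2 h1; rewrite prod_normE ge_max.
by apply/andP; split; rewrite -(@expr_le1 _ 2) // real_normK ?num_real //; lra.
Qed.

Definition cis a : R * R := (cos a, sin a).

Lemma sqnorm_cis a : sqnorm (cis a) = 1.
Proof. exact: cos2Dsin2. Qed.

Lemma continuous_cis : continuous cis.
Proof.
move=> a; exact: (cvg_pair (@continuous_cos R a) (@continuous_sin R a)).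
Qed.

(** [cos (b - a) = 1] forces [sin ((b - a) / 2) = 0], which is impossible when
    [0 < b - a < 2 pi]. *)
Lemma cis_inj a b : a < b + 2 * pi -> b < a + 2 * pi -> cis a = cis b -> a = b.
Proof.
wlog ab : a b / a <= b.
  move=> W ab ba E; case: (leP a b) => [|/ltW] H; first exact: W.
  by apply/esym/W.
move=> _ ba [ca sa]; apply/eqP; move: ab; rewrite le_eqVlt => /orP[//|ab].
have c1 : cos (b - a) = 1.
  by rewrite cosB ca sa -!expr2 cos2Dsin2.
have : 0 < sin ((b - a) / 2) by apply: sin_gt0_pi; apply/andP; split; lra.
have -> : sin ((b - a) / 2) = 0; last by rewrite ltxx.
apply/eqP; rewrite -sqrf_eq0 sin2cos2; apply/eqP.
have := cos_mulr2n ((b - a) / 2).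
have -> : (b - a) / 2 *+ 2 = b - a by rewrite -mulr_natr mulfVK.
rewrite c1; set x := cos _ ^+ 2; rewrite -mulr_natr; lra.
Qed.

Variables (I : finType) (A : pred I) (P : I -> R * R).

(** The distance (for the maximum norm) to the points that have to stay in place,
    truncated at [1] to keep the factor [1 - clearance p / 4] of [shrink] positive. *)
Definition clearance p : R := \big[Order.min/1]_(i | A i) `|p - P i|.

Definition shrink p : R * R := (1 - clearance p / 4) *: p.

Lemma clearance_ge0 p : 0 <= clearance p.
Proof.
by apply: (big_ind (fun x => 0 <= x)) => // x y x0 y0; rewrite le_min x0.
Qed.

Lemma clearance_le1 p : clearance p <= 1.
Proof. exact: bigmin_le_id. Qed.

Lemma clearance0 i : A i -> clearance (P i) = 0.
Proof.
move=> Ai; apply/eqP; rewrite eq_le clearance_ge0 andbT.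
by rewrite (le_trans (bigmin_le_cond _ _ Ai)) // subrr normr0.
Qed.

Lemma clearance_gt0 p : (forall i, A i -> p != P i) -> 0 < clearance p.
Proof.
move=> pP; apply: lt_bigmin => // i Ai.
by rewrite normr_gt0 subr_eq0 pP.
Qed.

Lemma clearance_lipschitz p q : `|clearance p - clearance q| <= `|p - q|.
Proof.
apply: (big_ind2 (fun x y => `|x - y| <= `|p - q|)).
- by rewrite subrr normr0.
- move=> x y z t; rewrite !ler_distl => /andP[x1 x2] /andP[z1 z2].
  by rewrite /Order.min; do 2!case: ltP => ?; apply/andP; split; lra.
- move=> i _; apply: le_trans (ler_dist_dist _ _) _.
  by rewrite opprB addrA subrK.
Qed.

Lemma continuous_clearance : continuous clearance.
Proof.
move=> p; apply/cvgrPdist_le => e e0; near=> q.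
apply: le_trans (clearance_lipschitz _ _) _; near: q.
by have /cvgrPdist_le/(_ e e0) : id x @[x --> p] --> p by exact: cvg_id.
Unshelve. all: by end_near. Qed.

Lemma continuous_retract : continuous shrink.
Proof.
move=> p; apply: (@cvgZ _ _ _ _ _ (fun q => 1 - clearance q / 4) id); last exact: cvg_id.
apply: cvgB; first exact: cvg_cst.
by apply: cvgMl; exact: continuous_clearance.
Qed.

Lemma shrink_fix i : A i -> shrink (P i) = P i.
Proof. by move=> Ai; rewrite /shrink clearance0 // mul0r subr0 scale1r. Qed.

Lemma shrink_open p : open_disk p -> open_disk (shrink p).
Proof.
rewrite -[open_disk p]/(is_true (sqnorm p < 1)) => p1.
rewrite -[open_disk _]/(is_true (sqnorm (shrink p) < 1)) sqnormZ.
have := clearance_ge0 p; have := clearance_le1 p => h1 h0.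
have : 0 <= sqnorm p by rewrite /sqnorm addr_ge0 ?sqr_ge0.
nra.
Qed.

(** The map differs from the identity by [clearance p / 4 *: p], which has Lipschitz
    constant at most [1/2] on the disk. *)
Lemma shrink_inj p q : sqnorm p <= 1 -> sqnorm q <= 1 ->
  shrink p = shrink q -> p = q.
Proof.
move=> /norm_le1 p1 /norm_le1 q1; rewrite /shrink !scalerBl !scale1r => E.
have {}E : p - q = (clearance p / 4) *: (p - q)
                 + ((clearance p - clearance q) / 4) *: q.
  rewrite mulrBl scalerBl scalerBr addrA subrK.
  have X (V : zmodType) (x y u v : V) : x - u = y - v -> x - y = u - v.
    move/eqP; rewrite subr_eq => /eqP ->.
    by rewrite addrAC [y - v]addrC addrK addrC.
  exact: X.
apply/eqP; rewrite -subr_eq0 -normr_eq0 eq_le normr_ge0 andbT.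
have := clearance_lipschitz p q; have := clearance_ge0 p; have := clearance_le1 p.
have : `|p - q| <= clearance p / 4 * `|p - q| + `|clearance p - clearance q| / 4 * `|q|.
  rewrite {1}E (le_trans (ler_normD _ _)) // !normrZ.
  rewrite (ger0_norm (clearance_ge0 p)).
  by have -> : `|4^-1| = 4^-1 :> R by rewrite ger0_norm.
have := normr_ge0 q; have := normr_ge0 (p - q).
have := normr_ge0 (clearance p - clearance q).
nra.
Qed.

(** The image of the disk meets the radius through [p] in the segment that ends
    at the image of [p], as the map is increasing along radii. *)
Lemma shrink_ray p q a : sqnorm p = 1 -> sqnorm q <= 1 -> 0 <= a ->
  a *: p = shrink q -> a <= 1 - clearance p / 4.
Proof.
move=> p1 q1 a0 E.
have h0 := clearance_ge0 q; have h1 := clearance_le1 q.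
have d0 : 0 < 1 - clearance q / 4 by lra.
pose b := a / (1 - clearance q / 4).
have qE : q = b *: p.
  by rewrite /b mulrC -scalerA E /shrink scalerA mulVf ?scale1r // gt_eqF.
have b0 : 0 <= b by rewrite divr_ge0 // ltW.
have b1 : b <= 1.
  by move: q1; rewrite qE sqnormZ p1 mulr1 expr_le1.
have aE : a = b * (1 - clearance q / 4) by rewrite /b divfK // gt_eqF.
have pn : `|p| <= 1 by rewrite norm_le1 ?p1.
have : clearance p - clearance q <= 1 - b.
  apply: le_trans (ler_norm _) (le_trans (clearance_lipschitz _ _) _).
  rewrite qE -{1}[p]scale1r -scalerBl normrZ ger0_norm ?subr_ge0 //.
  by rewrite ler_piMr ?subr_ge0.
have := clearance_ge0 p; have := clearance_le1 p.
nra.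
Qed.

Lemma shrink_miss p q a : sqnorm p = 1 -> sqnorm q <= 1 ->
  1 - clearance p / 4 < a -> a *: p <> shrink q.
Proof.
move=> p1 q1 ap E; have := shrink_ray p1 q1 _ E.
have := clearance_ge0 p; have := clearance_le1 p => h1 h0.
have a0 : 0 <= a by lra.
by move/(_ a0); rewrite leNgt ap.
Qed.

End Plane.

(** * Planarity of the modified networks *)

Section Embedding.
Set Implicit Arguments.
Unset Strict Implicit.
Unset Printing Implicit Defensive.
Import numFieldNormedType.Exports.
Local Open Scope classical_set_scope.
Context {R : realType} {m : nat}.
Implicit Types N : network R m.

Lemma embedding_pos_le1 N pos arc (x : vertex N) : disk_embedding pos arc ->
  sqnorm (pos x) <= 1.
Proof.
case=> _ [theta [_ _ pk]] pint _ _ _ _ _ _; case: x => [k|x].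
  by rewrite pk -[(_, _)]/(cis _) sqnorm_cis.
exact/ltW/pint.
Qed.

Lemma embedding_arc_le1 N pos arc (e : edge N) t : @disk_embedding R m N pos arc ->
  0 < t < 1 -> sqnorm (arc e t) <= 1.
Proof. by move=> D t01; exact/ltW/(de_inside D). Qed.

Lemma continuous_radial (u : R -> R) (p : R -> R * R) : continuous u -> continuous p ->
  continuous (fun s => u s *: p s).
Proof. by move=> cu cp s; apply: cvgZ; [exact: cu|exact: cp]. Qed.

Lemma continuous_affine (a b : R) : continuous (fun s : R => a + s * b).
Proof.
by move=> s; apply: cvgD; [exact: cvg_cst|apply: cvgMl; exact: cvg_id].
Qed.

(** The disk is shrunk with all boundary vertices fixed.  The new edge follows the
    arc of the circle from [k] to [l], on which there is no other boundary vertex,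
    halfway between the circle and its image (whence [8] in place of [4]). *)
Lemma planar_add_edge N (k l : 'I_m) t : 0 < t -> l = k.+1 :> nat ->
  planar_network N -> planar_network (add_edge k l t N).
Proof.
move=> t0 lk [EN [pos [arc D]]]; split; first exact: electrical_add_edge.
have [theta [th_lt th_2pi posE]] := de_boundary D.
pose P j := pos (inl j); pose f := shrink predT P; pose h := clearance predT P.
pose ang s := theta k + s * (theta l - theta k).
pose new s := (1 - h (cis (ang s)) / 8) *: cis (ang s).
have thkl : theta k < theta l by apply: th_lt; rewrite lk.
have posk j : pos (inl j) = cis (theta j) by exact: posE.
have ang_in s : 0 < s < 1 -> theta k < ang s < theta l.
  by case/andP=> s0 s1; apply/andP; split; rewrite /ang; nra.
have h1 s : h s <= 1 by exact: clearance_le1.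
have h_gt0 s : 0 < s < 1 -> 0 < h (cis (ang s)).
  move=> s01; have /andP[sk sl] := ang_in s s01.
  apply: clearance_gt0 => j _; rewrite /P posk; apply/eqP => E.
  have := th_2pi k j; have := th_2pi j l => jl kj.
  have aE : ang s = theta j by apply: cis_inj E; lra.
  have [jk|kj'|jkE] := ltngtP j k.
  - have := th_lt _ _ jk; lra.
  - have : (l <= j)%N by rewrite lk.
    rewrite leq_eqVlt => /orP[/eqP/val_inj ljE|/th_lt]; last by lra.
    by rewrite ljE in sl; lra.
  - by move/val_inj: jkE => jkE; rewrite jkE in aE; lra.
have new_neq s q : 0 < s < 1 -> sqnorm q <= 1 -> new s <> f q.
  move=> s01 q1; apply: shrink_miss => //; first exact: sqnorm_cis.
  by rewrite -/h; have := h_gt0 s s01; lra.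
have finj p q : sqnorm p <= 1 -> sqnorm q <= 1 -> f p = f q -> p = q.
  exact: shrink_inj.
have pos1 x := embedding_pos_le1 x D.
have arc1 e s := @embedding_arc_le1 N pos arc e s D.
exists (fun x : vertex N => f (pos x)).
exists (fun e : option (edge N) => if e is Some e' then f \o arc e' else new).
split.
- by move=> x y /finj E; apply: (de_pos_inj D); exact: E.
- by exists theta; split=> // j; rewrite /f (@shrink_fix _ _ predT P j) //; exact: posE.
- by move=> x; apply/shrink_open/(de_interior D).
- case=> [e|]; first apply: within_continuous_comp (@de_continuous _ _ _ _ _ D e).
    by move=> p _; exact: continuous_retract.
  apply: continuous_subspaceT; apply: continuous_radial; last first.
    by move=> s; apply: continuous_comp; [exact: continuous_affine|exact: continuous_cis].
  move=> s; apply: cvgB; first exact: cvg_cst.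
  apply: cvgMl; apply: continuous_comp; last exact: continuous_clearance.
  by apply: continuous_comp; [exact: continuous_affine|exact: continuous_cis].
- case=> [e|] /=; first by have [-> ->] := de_ends D e.
  rewrite /f !(@shrink_fix _ _ predT P _ isT) /new.
  have -> : ang 0 = theta k by rewrite /ang mul0r addr0.
  have -> : ang 1 = theta l by rewrite /ang mul1r addrC subrK.
  by rewrite -!posk /h !(@clearance0 _ _ predT P _ isT) mul0r subr0 !scale1r.
- case=> [e|] s s01; first exact/shrink_open/(de_inside D).
  rewrite -[open_disk _]/(is_true (sqnorm (new s) < 1)) sqnormZ sqnorm_cis mulr1.
  by have := h_gt0 s s01; have := h1 (cis (ang s)); nra.
- case=> [e|] s t' s01 t01.
    by move/finj => E; apply: (de_simple D) (E _ _) => //; exact: arc1.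
  move=> E; have sE : (1 - h (cis (ang s)) / 8) ^+ 2 = (1 - h (cis (ang t')) / 8) ^+ 2.
    by have := congr1 (@sqnorm R) E; rewrite !sqnormZ !sqnorm_cis !mulr1.
  have hs := h1 (cis (ang s)); have ht := h1 (cis (ang t')).
  have {}sE : 1 - h (cis (ang s)) / 8 = 1 - h (cis (ang t')) / 8.
    by apply/eqP; rewrite -(@eqrXn2 _ 2) //; [exact/eqP|lra|lra].
  move: E; rewrite /new sE => /scalerI E.
  have aE : ang s = ang t'.
    have := ang_in s s01; have := ang_in t' t01.
    have := th_2pi k l => kl /andP[? ?] /andP[? ?].
    apply: cis_inj; [lra|lra|apply: E]; rewrite gt_eqF //; lra.
  move: aE; rewrite /ang => /addrI /mulIf; apply; rewrite gt_eqF //; lra.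
- case=> [e|] s x s01.
    by move/finj => E; exact: (de_vertex D s01 (E (arc1 _ _ s01) (pos1 _))).
  exact: new_neq.
- case=> [e|] [e'|] s t' ee' s01 t01 //.
  + move/finj => E; have {}E := E (arc1 _ _ s01) (arc1 _ _ t01).
    exact: (de_disjoint D ee' s01 t01 E).
  + by apply/nesym/new_neq => //; exact: arc1.
  + by apply: new_neq => //; exact: arc1.
Qed.

(** The disk is shrunk with all boundary vertices fixed except [k].  The new edge is
    the radial segment from the image of [k] to its old place, now the position
    of the new vertex. *)
Lemma planar_add_spike N (k : 'I_m) t : 0 < t ->
  planar_network N -> planar_network (add_spike k t N).
Proof.
move=> t0 [EN [pos [arc D]]]; split; first exact: electrical_add_spike.
have [theta [th_lt th_2pi posE]] := de_boundary D.
pose P j := pos (inl j); pose f := shrink (predC1 k) P; pose h := clearance (predC1 k) P.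
pose pk := pos (inl k).
pose new s := (1 - s * (h pk / 4)) *: pk.
have pk1 : sqnorm pk = 1 by rewrite /pk posE -[(_, _)]/(cis _) sqnorm_cis.
have h1 p : h p <= 1 by exact: clearance_le1.
have h_gt0 : 0 < h pk.
  apply: clearance_gt0 => j jk; apply: contra jk => /eqP/(de_pos_inj D) [->].
  by rewrite /= eqxx.
have new_neq s q : s < 1 -> sqnorm q <= 1 -> new s <> f q.
  by move=> s1 q1; apply: shrink_miss => //; rewrite -/h; nra.
have pk_neq q : sqnorm q <= 1 -> pk <> f q.
  by move=> q1; have := new_neq 0 q ltr01 q1; rewrite /new mul0r subr0 scale1r.
have open_neq p : open_disk p -> p <> pk.
  move=> + E; rewrite E -[open_disk _]/(is_true (sqnorm pk < 1)) pk1.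
  by rewrite ltxx.
have new_open s : 0 < s < 1 -> open_disk (new s).
  move=> /andP[s0 s1]; rewrite -[open_disk _]/(is_true (sqnorm (new s) < 1)).
  have hp := h1 pk; rewrite sqnormZ pk1 mulr1.
  have : 0 < s * (h pk / 4) by nra.
  have : s * (h pk / 4) < 1 by nra.
  nra.
have finj p q : sqnorm p <= 1 -> sqnorm q <= 1 -> f p = f q -> p = q.
  exact: shrink_inj.
have pos1 x := embedding_pos_le1 x D.
have arc1 e s := @embedding_arc_le1 N pos arc e s D.
pose pos' (x : 'I_m + option (Defs.interior N)) := match x with
  | inl l => pos (inl l) | inr None => f pk | inr (Some y) => f (pos (inr y)) end.
have pos'E x : pos' (demote k x) = f (pos x).
  case: x => [l|x] //=; case: eqVneq => [->//|lk] /=.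
  by rewrite /f (@shrink_fix _ _ (predC1 k) P l).
exists pos'.
exists (fun e : option (edge N) => if e is Some e' then f \o arc e' else new).
split.
- have ne x : pos' (inl k) <> pos' (demote k x) by rewrite pos'E; exact: pk_neq.
  apply: demoteP => [|x]; apply: demoteP => [//|y].
  + by move/ne.
  + by move/esym/ne.
  + by rewrite !pos'E => /finj E; congr (demote k _); apply: (de_pos_inj D); exact: E.
- by exists theta.
- move=> [y|]; first exact/shrink_open/(de_interior D).
  rewrite -[open_disk _]/(is_true (sqnorm (f pk) < 1)) sqnormZ pk1 mulr1 -/h.
  have hp := h1 pk; nra.
- case=> [e|]; first apply: within_continuous_comp (@de_continuous _ _ _ _ _ D e).
    by move=> p _; exact: continuous_retract.
  apply: continuous_subspaceT; apply: continuous_radial => s; last exact: cvg_cst.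
  apply: cvgB; first exact: cvg_cst.
  by apply: cvgMl; exact: cvg_id.
- case=> [e|].
    by have [E0 E1] := de_ends D e; rewrite /= E0 E1 -!pos'E.
  by rewrite /= /new mul0r subr0 scale1r mul1r.
- case=> [e|] s s01; first exact/shrink_open/(de_inside D).
  exact: new_open.
- case=> [e|] s t' s01 t01.
    by move/finj => E; apply: (de_simple D) (E _ _) => //; exact: arc1.
  move=> E; have hp := h1 pk; case/andP: s01 => s0 s1; case/andP: t01 => t0' t1.
  have : (1 - s * (h pk / 4)) ^+ 2 = (1 - t' * (h pk / 4)) ^+ 2.
    by have := congr1 (@sqnorm R) E; rewrite !sqnormZ pk1 !mulr1.
  move/eqP; rewrite eqrXn2 //; [|nra|nra].
  move/eqP/addrI/oppr_inj/mulIf; apply; rewrite gt_eqF //; lra.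
- case=> [e|] s x s01; move: x; apply: (@demoteP _ _ N k) => [|x]; rewrite ?pos'E.
  + exact/open_neq/shrink_open/(de_inside D).
  + by move/finj => E; exact: (de_vertex D s01 (E (arc1 _ _ s01) (pos1 _))).
  + exact/open_neq/new_open.
  + by case/andP: s01 => _ s1; exact: new_neq.
- case=> [e|] [e'|] s t' ee' s01 t01 //.
  + move/finj => E; have {}E := E (arc1 _ _ s01) (arc1 _ _ t01).
    exact: (de_disjoint D ee' s01 t01 E).
  + by case/andP: (t01) => _ t1; apply/nesym/new_neq => //; exact: arc1.
  + by case/andP: (s01) => _ s1; apply: new_neq => //; exact: arc1.
Qed.

End Embedding.

(** * The action *)

Section Generators.
Set Implicit Arguments.
Unset Strict Implicit.
Unset Printing Implicit Defensive.
Context {R : realType} {n : nat}.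

Lemma planar_vop i a (N : network R n.+1) : (1 <= i <= 2 * n)%N -> 0 <= a ->
  planar_network N -> planar_network (vop i a N).
Proof.
move=> /andP[i0 ln] a0 pN; rewrite /vop; case: eqVneq => // an0.
have {an0}a0 : 0 < a by rewrite lt_neqAle eq_sym an0.
case: ifP => oi; first exact: planar_add_spike.
apply: planar_add_edge => //; rewrite /bdry !inordK //=; lia.
Qed.

Lemma act_ugen i a (N : network R n.+1) : (1 <= i <= 2 * n)%N -> 0 <= a ->
  electrical N ->
  den (ugen n i a) (reduce (response N)) \in unitmx /\
  act (ugen n i a) (response N) = response (vop i a N).
Proof.
move=> iB a0 EN; rewrite /vop; case: eqVneq => [->|an0].
  have -> : ugen n i 0 = 1%:M :> 'M[R]_(n + n) by rewrite ugenE scale0r addr0.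
  by rewrite den1 unitmx1 /act moebius1 reduceK.
have {an0}a0 : 0 < a by rewrite lt_neqAle eq_sym an0.
case: ifP => [oi|/negbT oi]; last exact: act_ugen_even.
by apply: act_ugen_odd => //; case/andP: iB.
Qed.

Lemma act_mul (g h : 'M[R]_(n + n)) (L : 'M[R]_n.+1) : den h (reduce L) \in unitmx ->
  den g (reduce (act h L)) \in unitmx ->
  den (g *m h) (reduce L) \in unitmx /\ act (g *m h) L = act g (act h L).
Proof.
move=> hU; rewrite reduce_act => gU; have [dU E] := moebius_mul hU gU.
by split=> //; rewrite {1}/act E -reduce_act.
Qed.

(** The denominator of a product is invertible because the second factor already
    sends [L] to the response matrix of a planar network. *)
Lemma EL_ge0_stable (g : 'M[R]_(n + n)) (L : 'M[R]_n.+1) :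
  EL_ge0 g -> planar_responses L ->
  den g (reduce L) \in unitmx /\ planar_responses (act g L).
Proof.
move=> Sg; elim: Sg L => {g} [i a iB a0|g h _ IHg _ IHh] L XL.
  case: XL => N pN ->; have [dU ->] := act_ugen iB a0 pN.1.
  by split=> //; exists (vop i a N) => //; exact: planar_vop.
have [hU XhL] := IHh L XL; have [gU XgL] := IHg _ XhL.
by have [dU ->] := act_mul hU gU.
Qed.

End Generators.

Theorem theorem4p3 (R : realType) (n : nat) (hn : (1 <= n)%N) :
  exists act : 'M[R]_(n + n) -> 'M[R]_n.+1 -> 'M[R]_n.+1,
    semigroup_action (@EL_ge0 R n) (@planar_responses R n.+1) act /\
    (forall (i : nat) (a : R) (N : network R n.+1),
        (1 <= i <= 2 * n)%N -> 0 <= a -> planar_network N ->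
        act (ugen n i a) (response N) = response (vop i a N)).
Proof.
exists act; split; last by move=> i a N iB a0 pN; have [] := act_ugen iB a0 pN.1.
split.
- by move=> g L Sg XL; have [] := EL_ge0_stable Sg XL.
- move=> g h L Sg Sh XL; have [hU XhL] := EL_ge0_stable Sh XL.
  by have [gU _] := EL_ge0_stable Sg XhL; have [] := act_mul hU gU.
- by move=> L _ [N [EN _] ->]; rewrite /act moebius1 reduceK.
Qed.
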